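(* For every configuration $\sigma\in\mathcal X\setminus\{\mathbf 1,\mathbf 2,\mathbf 3\}$, \[ \mathcal V_\sigma<\mathcal V_{\mathbf 1}<\mathcal V_{\mathbf 2}. \]
   Context: Let $K,L$ be positive integers and let $(V,E)$ be the $K\times L$ rectangular lattice graph with periodic boundary conditions: $V=(\mathbb Z/K\mathbb Z)\times(\mathbb Z/L\mathbb Z)$ and $E$ is the set of nearest-neighbour edges. Let $0<h_1<h_2<h_3<1$ be real numbers. Standing assumptions: (A) $K$ and $L$ are both greater than $\frac{3}{h_3-h_2}$ and greater than $\frac{3}{h_2-h_1}$; (B) $a(h_2-h_1)+b(h_3-h_2)\notin\mathbb Z$ for all $(a,b)\in\mathbb Z^2\setminus\{(0,0)\}$. The configuration space is $\mathcal X=\{1,2,3\}^V$, with Hamiltonian \[ H(\sigma)=-\sum_{\{x,y\}\in E}\mathbf 1_{\{\sigma(x)=\sigma(y)\}}-\sum_{x\in V}h_{\sigma(x)} . \] For $i\in\{1,2,3\}$, $\mathbf i\in\mathcal X$ is the configuration with constant spin $i$. Two configurations are adjacent if they differ at exactly one site. A path from $\sigma$ to $\eta$ is a finite sequence of successively adjacent configurations starting at $\sigma$ and ending at $\eta$. The communication height $\Phi(\sigma,\eta)$ is the minimum over all paths from $\sigma$ to $\eta$ of the maximum of $H$ along the path; for $A\subseteq\mathcal X$, $\Phi(\sigma,A)=\min_{\eta\in A}\Phi(\sigma,\eta)$ and $\Gamma(\sigma,A)=\Phi(\sigma,A)-H(\sigma)$. The stability level of $\sigma$ is $\mathcal V_\sigma=\Gamma(\sigma,I_\sigma)$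 with $I_\sigma=\{\eta\in\mathcal X:H(\eta)<H(\sigma)\}$, and $\mathcal V_\sigma=\infty$ if $I_\sigma=\emptyset$. *)

(* Defs.v *)
From HB Require Import structures.
From mathcomp Require Import all_boot all_order all_algebra.
From mathcomp Require Import all_classical all_reals ereal.
Set Implicit Arguments.
Unset Strict Implicit.
Unset Printing Implicit Defensive.
Import Order.TTheory GRing.Theory Num.Theory.
Local Open Scope ring_scope.

(** The spins 1, 2, 3 are the elements of value 0, 1, 2 of ['I_3]. *)
Definition spin := 'I_3.
Definition s1 : spin := @Ordinal 3 0 isT.
Definition s2 : spin := @Ordinal 3 1 isT.
Definition s3 : spin := @Ordinal 3 2 isT.

(** ['I_n] with its cyclic successor [ordS] plays the role of Z/nZ:
    unlike ['Z_n], it has n elements for every positive n. *)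
Definition site (K L : nat) : finType := ('I_K * 'I_L)%type.

Definition cyc_nbr (n : nat) (i j : 'I_n) : bool :=
  (j == ordS i) || (i == ordS j).

Definition nbr (K L : nat) (x y : site K L) : bool :=
  (x != y) &&
  ((x.1 == y.1) && cyc_nbr x.2 y.2 || (x.2 == y.2) && cyc_nbr x.1 y.1).

(** An edge is the unordered pair of its endpoints. *)
Definition edges (K L : nat) : {set {set site K L}} :=
  [set [set x; y] | x in [set: site K L], y in [set: site K L] & nbr x y].

Definition config (K L : nat) : finType := {ffun site K L -> spin}.

Definition const_config (K L : nat) (i : spin) : config K L := [ffun => i].

Section Model.
Variables (R : realType) (K L : nat) (h : spin -> R).
Implicit Types (s t : config K L) (A : {set config K L}).

(** On an edge this says that the two endpoints have equal spins: see
    [monochromatic2]. *)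
Definition monochromatic s (e : {set site K L}) : bool :=
  [forall x in e, forall y in e, s x == s y].

Definition energy s : R :=
  - (\sum_(e in edges K L) (monochromatic s e)%:R) - \sum_x h (s x).

Definition adjacent s t : bool := #|[set x | s x != t x]| == 1%N.

(** The path visiting [s] and then the members of [p] in order. *)
Definition is_path s t (p : seq (config K L)) : Prop :=
  path adjacent s p /\ last s p = t.

Definition path_height s (p : seq (config K L)) : R :=
  \big[Order.max/energy s]_(u <- p) energy u.

(** The infimum is a minimum: see [comm_height_attained]. *)
Definition comm_height s t : \bar R :=
  ereal_inf [set (path_height s p)%:E | p in [set p | is_path s t p]].

Definition comm_height_set s A : \bar R :=
  \big[Order.min/+oo%E]_(t in A) comm_height s t.

Definition barrier s A : \bar R := (comm_height_set s A - (energy s)%:E)%E.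

Definition lower_energy s : {set config K L} := [set t | energy t < energy s].

Definition stability_level s : \bar R :=
  if lower_energy s == finset.set0 then +oo%E else barrier s (lower_energy s).

Lemma monochromatic2 s x y : monochromatic s [set x; y] = (s x == s y).
Proof.
apply/forall_inP/eqP => [m|sxy u].
  have /forall_inP/(_ y) := m x (set21 x y).
  by rewrite set22 => /(_ isT)/eqP.
rewrite in_set2 => /orP[]/eqP->; apply/forall_inP => v;
  by rewrite in_set2 => /orP[]/eqP->; rewrite ?sxy.
Qed.

Lemma path_exists s t : exists p, is_path s t p.
Proof.
have [n] := ubnP #|[set x | s x != t x]|.
elim: n s => // n IHn s; rewrite ltnS => le_n.
have [d0|[x]] := set_0Vmem [set x | s x != t x].
  exists [::]; split=> //=; apply/ffunP => x.
  have : x \notin [set x | s x != t x] by rewrite d0 inE.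
  by rewrite inE negbK => /eqP.
move=> xd; have := xd; rewrite inE => sx.
pose s' : config K L := [ffun y => if y == x then t x else s y].
have d' : [set y | s' y != t y] = [set y | s y != t y] :\ x.
  apply/setP => y; rewrite !inE ffunE.
  by case: (eqVneq y x) => [->|] //=; rewrite eqxx.
have [|p [pp lp]] := IHn s'.
  by rewrite d'; move: le_n; rewrite (cardsD1 x) xd.
exists (s' :: p); split => //=; rewrite pp andbT.
apply/cards1P; exists x; apply/setP => y; rewrite !inE ffunE.
by case: (eqVneq y x) => [->|]; rewrite ?sx ?eqxx.
Qed.

Lemma path_height_energy s p : exists u, path_height s p = energy u.
Proof.
rewrite /path_height; elim: p => [|v p [u IH]].
  by exists s; rewrite big_nil.
rewrite big_cons IH; case: (leP (energy v) (energy u)) => _; by [exists u|exists v].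
Qed.

Lemma comm_height_attained s t :
  exists2 p, is_path s t p & comm_height s t = (path_height s p)%:E.
Proof.
pose P u := `[< exists2 p, is_path s t p & path_height s p = energy u >].
have [p0 pp0] := path_exists s t.
have [u0 hu0] := path_height_energy s p0.
have Pu0 : P u0 by apply/asboolP; exists p0.
case: (arg_minP energy Pu0) => u /asboolP[p pp pu] umin.
exists p => //; apply/le_anti/andP; split.
  by apply: ereal_inf_lbound; exists p.
apply: le_ereal_inf_tmp => _ [q qp <-]; rewrite lee_fin pu.
have [v hv] := path_height_energy s q.
by rewrite hv; apply: umin; apply/asboolP; exists q.
Qed.

End Model.

(* Main.v *)
Require Import Defs.
From HB Require Import structures.
From mathcomp Require Import all_boot all_order all_algebra.
From mathcomp Require Import all_classical all_reals ereal.
From mathcomp Require Import zify ring lra.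
Import Order.TTheory GRing.Theory Num.Theory.
Local Open Scope ring_scope.

(** Row copying shows that [V_sigma <= 2].  Overwriting a row with the content
    of an adjacent row does not increase the number of vertical disagreements
    (triangle inequality), so the energy drops by at least the difference of the
    two row energies.  When this difference is nonnegative, the sites can be
    overwritten in cyclic order from a starting point at which all partial sums
    of the local changes are nonpositive; the two ends of the overwritten arc
    then cost at most 2.  If this never leads to a lower energy, all rows have
    the same energy, and so do all columns, before and after any such copy.
    Comparing column energies modulo the integers, condition (B) forces adjacent
    rows to be equal, and by symmetry adjacent columns: the configuration is
    constant.

    Leaving a constant configuration costs more than 2 at the first step, hence
    [V_sigma < V_1].  Replacing spins 1 and 2 by 1 in a path that realizes [V_2]
    gives a path from the constant 1 along which the energy relative to the
    start is strictly smaller, hence [V_1 < V_2]. *)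

(** * Cyclic successor on Z/nZ *)

Section Cycle.
Set Implicit Arguments.
Unset Strict Implicit.
Variable n : nat.
Implicit Types i j : 'I_n.

Lemma ordS_neq i : (1 < n)%N -> ordS i != i.
Proof.
move=> n_gt1; apply/eqP => /(congr1 val) /=; case: i => i lti /=.
have [lt1|ge1] := ltnP i.+1 n; first by rewrite modn_small //; lia.
have -> : i.+1 = n by lia.
by rewrite modnn; lia.
Qed.

Lemma ordSS_neq i : (2 < n)%N -> ordS (ordS i) != i.
Proof.
move=> n_gt2; apply/eqP => /(congr1 val) /=; case: i => i lti /=.
have [lt1|ge1] := ltnP i.+1 n; last first.
  have -> : i.+1 = n by lia.
  by rewrite modnn modn_small //; lia.
rewrite (modn_small lt1); have [lt2|ge2] := ltnP i.+2 n.
  by rewrite modn_small //; lia.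
have -> : i.+2 = n by lia.
by rewrite modnn; lia.
Qed.

Lemma ordS_inv_const (T : Type) (f : 'I_n -> T) :
  (forall i, f (ordS i) = f i) -> forall i j, f i = f j.
Proof.
move=> fS i j; have n_gt0 : (0 < n)%N by case: i => i /=; lia.
suff f0 k (ltk : (k < n)%N) : f (Ordinal ltk) = f (Ordinal n_gt0).
  by case: i j => i ? [j ?]; rewrite !f0.
elim: k ltk => [|k IH] ltk; first by congr f; apply: val_inj.
rewrite -(IH (ltnW ltk)) -[RHS]fS; congr f; apply: val_inj => /=.
by rewrite modn_small.
Qed.

End Cycle.

(** * The energy as a sum over sites *)

Section Energy.
Set Implicit Arguments.
Unset Strict Implicit.
Variables (R : realType) (K L : nat) (h : spin -> R).
Hypotheses (K_gt2 : (2 < K)%N) (L_gt2 : (2 < L)%N).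
Implicit Types (s t : config K L) (x y : site K L).

Definition step (b : bool) x : site K L :=
  if b then (ordS x.1, x.2) else (x.1, ordS x.2).

Lemma step_neq b x : step b x != x.
Proof.
case: x b => x1 x2 [] /=; rewrite xpair_eqE eqxx ?andbT /=;
  by apply: ordS_neq; lia.
Qed.

Lemma step_dir_inj b c x : step b x = step c x -> b = c.
Proof.
case: x b c => x1 x2 [] [] //= [].
  by move/eqP; rewrite (negbTE (ordS_neq _ _)) //; lia.
by move/esym/eqP; rewrite (negbTE (ordS_neq _ _)) //; lia.
Qed.

Lemma step2_neq b c x : step b (step c x) != x.
Proof.
case: x b c => x1 x2 [] [] /=; rewrite xpair_eqE /= ?eqxx ?andbT /=.
- exact: ordSS_neq.
- by rewrite negb_and ordS_neq //; lia.
- by rewrite negb_and ordS_neq //; lia.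
- exact: ordSS_neq.
Qed.

Definition bond (p : site K L * bool) : {set site K L} := [set p.1; step p.2 p.1].

(** If the endpoints were matched crosswise, two forward steps would return to the start; sides
    greater than 2 exclude this double edge. *)
Lemma bond_inj : injective bond.
Proof.
move=> [x b] [y c]; rewrite /bond /= => e.
have := set22 x (step b x); have := set21 x (step b x).
rewrite e !in_set2 => /orP[]/eqP xE /orP[]/eqP xbE.
- by move: (step_neq b x); rewrite xbE xE eqxx.
- by move: xbE; rewrite xE => /step_dir_inj ->.
- by move: (step2_neq b c y); rewrite -xE xbE eqxx.
- by move: (step_neq b x); rewrite xbE xE eqxx.
Qed.

Lemma edges_bond : edges K L = [set bond p | p in [set: site K L * bool]].
Proof.
apply/setP => e; apply/imset2P/imsetP => [[[x1 x2] [y1 y2] _]|[[[x1 x2] b] _ ->]].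
  rewrite inE /nbr /cyc_nbr /= => /and3P[_ _ /orP[]/andP[/eqP <-] /orP[]/eqP-> ->].
  - by exists ((x1, x2), false); rewrite ?finset.in_setT.
  - by exists ((x1, y2), false); rewrite ?finset.in_setT // /bond /= finset.setUC.
  - by exists ((x1, x2), true); rewrite ?finset.in_setT.
  - by exists ((y1, x2), true); rewrite ?finset.in_setT // /bond /= finset.setUC.
exists (x1, x2) (step b (x1, x2)); rewrite ?inE //= /nbr eq_sym step_neq /=.
by rewrite /cyc_nbr; case: b; rewrite /= !eqxx ?orbT.
Qed.

Definition dis (a b : spin) : R := (a != b)%:R.

(* The energy up to an additive constant: see [energyE]. *)
Definition excess s : R :=
  \sum_x (dis (s x) (s (step true x)) + dis (s x) (s (step false x)) - h (s x)).

Lemma energyE s : energy h s = excess s - (#|{: site K L}| * 2)%:R.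
Proof.
rewrite /energy edges_bond big_imset /=; last by move=> p q _ _; apply: bond_inj.
have -> : \sum_(p in [set: site K L * bool]) (monochromatic s (bond p))%:R
    = \sum_x \sum_(b : bool) (1 - dis (s x) (s (step b x))) :> R.
  rewrite pair_big /=; apply: eq_big => [p|p _]; first by rewrite inE.
  rewrite monochromatic2 /dis; case: eqP => _ /=; ring.
have -> : (#|{: site K L}| * 2)%:R = \sum_(x : site K L) (2 : R).
  by rewrite sumr_const natrM mulr_natl.
rewrite /excess -!sumrN -!big_split /=; apply: eq_bigr => x _.
rewrite big_bool /=; ring.
Qed.

End Energy.

Arguments dis {R}.

(** * Cyclic words of spins and their partial overwriting *)

Section Lines.
Set Implicit Arguments.
Unset Strict Implicit.
Variables (R : realType) (h : spin -> R).

Lemma dis_triangle (a b c : spin) : dis a c <= dis a b + dis b c :> R.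
Proof. by rewrite /dis; do 3 case: eqP => //= ?; rewrite ?addr0 ?add0r; lra || congruence. Qed.

Lemma dis_ge0 (a b : spin) : 0 <= dis a b :> R.
Proof. exact: ler0n. Qed.

Lemma dis_le1 (a b : spin) : dis a b <= 1 :> R.
Proof. by rewrite /dis lern1 leq_b1. Qed.

Lemma disxx (a : spin) : dis a a = 0 :> R.
Proof. by rewrite /dis eqxx. Qed.

Section OneLine.
Variable n : nat.
Implicit Types (a b u v : 'I_n -> spin) (A : pred 'I_n).

Definition local a i : R := dis (a i) (a (ordS i)) - h (a i).
Definition line_energy a : R := \sum_i local a i.
(** Hamming distance, the number of disagreements between two adjacent rows. *)
Definition gap a b : R := \sum_i dis (a i) (b i).

Definition mix A a b : 'I_n -> spin := fun i => if A i then b i else a i.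

(** A bond with both ends on the same side of [A] is a bond of [b] or of [a]; a bond crossing the
    boundary costs at most 1 in place of a nonnegative amount. *)
Lemma line_energy_mix A a b :
  line_energy (mix A a b) - line_energy a <=
    \sum_i (A i)%:R * (local b i - local a i) + \sum_i (A i != A (ordS i))%:R.
Proof.
rewrite /line_energy -sumrB -big_split /=; apply: ler_sum => i _.
rewrite /local /mix; case: (A i) (A (ordS i)) => [] [] /=;
  move: (dis_ge0 (a i) (a (ordS i))) (dis_le1 (a i) (b (ordS i)))
    (dis_ge0 (b i) (b (ordS i))) (dis_le1 (b i) (a (ordS i))); lra.
Qed.

(** Here [u] and [v] are the rows on both sides of [a]. At an overwritten site one disagreement
    vanishes and the other is that of [u] and [v], bounded by the triangle inequality through
    [a]. *)
Lemma gap_mix A a b u v : b = u \/ b = v ->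
  gap u (mix A a b) + gap (mix A a b) v <= gap u a + gap a v.
Proof.
rewrite /gap -!big_split /= => buv; apply: ler_sum => i _; rewrite /mix.
case: (A i) => //; case: buv => <-; rewrite disxx ?add0r ?addr0;
  exact: dis_triangle.
Qed.

(* The [k] consecutive sites of Z/nZ starting at [m]. *)
Definition arc (m k : nat) : pred 'I_n :=
  fun i => ((if m <= i then i - m else i + n - m) < k)%N.

Lemma arc_boundary m k : (m < n)%N -> (k <= n)%N ->
  \sum_i (arc m k i != arc m k (ordS i))%:R <= 2 :> R.
Proof.
move=> ltm lek; rewrite -natr_sum ler_nat.
(* Membership in the arc can change only after [pr], the site preceding the arc, and after [la], its
   last site. The empty arc has no boundary, so [la] is arbitrary for [k = 0]. *)
pose pr := if m is m'.+1 then m' else n.-1.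
pose la := if (k == 0)%N then m else if (m + k <= n)%N then (m + k).-1 else (m + k - n).-1.
have prn : (pr < n)%N by rewrite /pr; clear -ltm; case: m ltm => [|m]; lia .
have lan : (la < n)%N by rewrite /la; do !case: ifP; lia.
apply: (@leq_trans (\sum_i ((i == Ordinal prn) + (i == Ordinal lan)))%N).
  apply: leq_sum => i _.
  have oS : ordS i = (if i.+1 == n then 0%N else i.+1) :> nat.
    rewrite /=; case: eqP => [->|]; first by rewrite modnn.
    by move=> ne; rewrite modn_small //; case: i ne => i /=; lia.
  rewrite -!(inj_eq val_inj) /arc oS /= /pr /la.
  have := ltn_ord i; clear -ltm lek; case: m ltm => [|m] ltm lti; rewrite ?leq0n; do !case: ifP; lia.
have one j : (\sum_i (i == j) = 1)%N.
  by rewrite (bigD1 j) //= eqxx big1 // => i /negbTE->.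
by rewrite big_split /= !one.
Qed.

Lemma arc_next_inj m k i j : (m < n)%N ->
  arc m k i != arc m k.+1 i -> arc m k j != arc m k.+1 j -> i = j.
Proof.
move=> ltm; rewrite /arc => Hi Hj; apply: val_inj => /=.
have := ltn_ord i; have := ltn_ord j; move: Hi Hj; do !case: ifP; lia.
Qed.

(* Start the arc where the partial sums of [d] are maximal. *)
Lemma arc_sums_le0 (d : 'I_n -> R) : (0 < n)%N -> \sum_i d i <= 0 ->
  exists2 m, (m < n)%N & forall k, (k <= n)%N -> \sum_i (arc m k i)%:R * d i <= 0.
Proof.
move=> n_gt0 d_le0; pose P k := \sum_(i < n) (i < k)%:R * d i.
have Pn k : (n <= k)%N -> P k <= 0.
  move=> lek; apply: le_trans d_le0; rewrite /P; apply: ler_sum => i _.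
  by rewrite (leq_trans (ltn_ord i) lek) mul1r.
have P0 : P 0%N = 0 by rewrite /P big1 // => i _; rewrite mul0r.
have [m _ mmax] := @arg_maxP _ _ _ (Ordinal n_gt0) xpredT (fun i : 'I_n => P i) isT.
exists m => // k lek.
(* Truncated subtraction makes the last term [P 0 = 0] when the arc does not wrap around. When it
   does, [P (m + k)] is the full sum. *)
have -> : \sum_i (arc m k i)%:R * d i = P (m + k)%N - P m + P (m + k - n)%N.
  rewrite /P -sumrB -big_split /=; apply: eq_bigr => i _; rewrite -mulrBl -mulrDl.
  congr (_ * _).
  have : (arc m k i + (i < m)%N = (i < m + k)%N + (i < m + k - n)%N)%N.
    by have := ltn_ord i; have := ltn_ord m; rewrite /arc; case: ifP; lia.
  by move/(congr1 (fun c => c%:R : R)); rewrite !natrD; lra.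
have [lt|ge] := ltnP (m + k) n.
  have -> : (m + k - n = 0)%N by lia.
  by have := mmax (Ordinal lt) isT; rewrite P0 /=; lra.
have lt : (m + k - n < n)%N by have := ltn_ord m; lia.
by have := mmax (Ordinal lt) isT; have := Pn _ ge; rewrite /=; lra.
Qed.

End OneLine.
End Lines.

(** * Copying a row onto an adjacent one *)

Section Copy.
Set Implicit Arguments.
Unset Strict Implicit.
Variables (R : realType) (K L : nat) (h : spin -> R).
Hypotheses (K_gt2 : (2 < K)%N) (L_gt2 : (2 < L)%N).
Implicit Types (s t : config K L) (x : 'I_K).

Definition line s x : 'I_L -> spin := fun y => s (x, y).

Definition set_line s x (r : 'I_L -> spin) : config K L :=
  [ffun p => if p.1 == x then r p.2 else s p].

Lemma line_set_line s x r x' :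
  line (set_line s x r) x' =1 if x' == x then r else line s x'.
Proof. by move=> y; rewrite /line ffunE /=; case: eqP. Qed.

Lemma excess_lines s :
  excess h s = \sum_x (line_energy h (line s x) + gap R (line s x) (line s (ordS x))).
Proof.
rewrite /excess /line_energy /gap.
under [RHS]eq_bigr do rewrite -big_split.
rewrite pair_big /=; apply: eq_bigr => -[x y] _ /=.
rewrite /local /line; ring.
Qed.

Lemma energy_set_line s x r (a := line s (ordS x)) :
  energy h (set_line s (ordS x) r) - energy h s =
  (line_energy h r + gap R (line s x) r + gap R r (line s (ordS (ordS x)))) -
  (line_energy h a + gap R (line s x) a + gap R a (line s (ordS (ordS x)))).
Proof.
have xS : x != ordS x by rewrite eq_sym ordS_neq //; lia.
have xSS : ordS (ordS x) != ordS x by rewrite ordS_neq //; lia.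
rewrite !energyE // !excess_lines.
(* The modified row enters only the terms of index [ordS x] and, through its gap, of index [x]. *)
rewrite (bigD1 (ordS x)) // [in X in _ - X](bigD1 (ordS x)) //=.
rewrite (bigD1 x) // [in X in _ - X](bigD1 x) //=.
have El x' : line (set_line s (ordS x) r) x' = if x' == ordS x then r else line s x'.
  by apply/funext => y; rewrite line_set_line; case: ifP.
rewrite !El eqxx (negbTE xS) (negbTE xSS).
under eq_bigr => x' /andP[n1 n2].
  rewrite !El (negbTE n1) (_ : (ordS x' == ordS x) = false); last first.
    by apply: contra_neqF n2 => /eqP/(can_inj (@ordSK _))->.
  over.
rewrite /a; ring.
Qed.

(** The bound is imposed on the end of each step only; the energy of the starting point is bounded
    separately. *)
Definition below (B : R) : rel (config K L) :=
  [rel s t | adjacent s t && (energy h t <= B)].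

Lemma connect_below_sub B B' s t : B <= B' ->
  connect (below B) s t -> connect (below B') s t.
Proof.
move=> leB; apply: connect_sub => u v uv; apply: connect1.
by case/andP: uv => uv vB; rewrite /below /= uv (le_trans vB leB).
Qed.

Lemma connect_below1 B s t : energy h t <= B ->
  (forall p q, s p != t p -> s q != t q -> p = q) -> connect (below B) s t.
Proof.
move=> tB st; have [->|/eqP nst] := eqVneq s t; first exact: connect0.
apply: connect1; rewrite /below /= tB andbT; apply/cards1P.
have [p sp] : exists p, s p != t p.
  apply/existsP; apply: contra_notT nst => /existsPn e.
  by apply/ffunP => p; apply/eqP; rewrite -[_ == _]negbK.
exists p; apply/setP => q; rewrite !inE.
by apply/idP/eqP => [sq|->//]; apply: st.
Qed.

Lemma copy_line s x r (a := line s (ordS x)) :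
  r = line s x \/ r = line s (ordS (ordS x)) ->
  line_energy h r <= line_energy h a ->
  connect (below (energy h s + 2)) s (set_line s (ordS x) r) /\
  energy h (set_line s (ordS x) r) <= energy h s + line_energy h r - line_energy h a.
Proof.
move=> rE ra; have L_gt0 : (0 < L)%N by lia.
have [|m ltm arc_le0] := @arc_sums_le0 R L (fun y => local h r y - local h a y) L_gt0.
  by rewrite sumrB subr_le0.
(* The path: [w k] has the first [k] sites of the arc overwritten, from [w 0 = s] to the finished
   copy [w L]. *)
pose w k := set_line s (ordS x) (mix (arc m k) a r).
have w_ge k : energy h (w k) <= energy h s
    + line_energy h (mix (arc m k) a r) - line_energy h a.
  have := energy_set_line s x (mix (arc m k) a r).
  have := gap_mix R (arc m k) a rE.
  rewrite -/(w k) /= -/a; lra.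
have wL : w L = set_line s (ordS x) r.
  apply/ffunP => -[x' y]; rewrite !ffunE /mix /arc /=.
  by have := ltn_ord y; case: ifP => //; do !case: ifP => //; lia.
have mixL : mix (arc m L) a r = r.
  apply/funext => y; rewrite /mix /arc.
  by have := ltn_ord y; do !case: ifP => //; lia.
split; last by have := w_ge L; rewrite wL mixL.
have w0 : w 0%N = s.
  by apply/ffunP => -[x' y]; rewrite !ffunE /=; case: eqP => // ->.
(* The gaps do not grow, the partial sum of local changes is nonpositive, and the two ends of the
   arc cost at most 2. *)
have wB k : (k <= L)%N -> energy h (w k) <= energy h s + 2.
  move=> lek; have := w_ge k; have := line_energy_mix h (arc m k) a r.
  have := arc_le0 k lek; have := arc_boundary R ltm lek; lra.
suff wk k : (k <= L)%N -> connect (below (energy h s + 2)) s (w k).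
  by rewrite -wL; apply: wk.
elim: k => [|k IH] lek; first by rewrite w0 connect0.
apply: connect_trans (IH (ltnW lek)) _; apply: connect_below1; first exact: wB.
have diff p : w k p != w k.+1 p -> p.1 = ordS x /\ arc m k p.2 != arc m k.+1 p.2.
  rewrite !ffunE; have [pE|_] := eqVneq p.1 (ordS x); last by rewrite eqxx.
  by move=> ne; split=> //; move: ne; apply: contraNneq; rewrite /mix => ->.
move=> [p1 p2] [q1 q2] /diff[/= -> dp] /diff[/= -> dq].
by rewrite (arc_next_inj ltm dp dq).
Qed.

(** Connectivity form of a stability level of at most 2. *)
Definition relaxes s : Prop :=
  exists2 t, connect (below (energy h s + 2)) s t & energy h t < energy h s.

Lemma relaxes_trans s t : connect (below (energy h s + 2)) s t ->
  energy h t <= energy h s -> relaxes t -> relaxes s.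
Proof.
move=> st ts [u tu ut]; exists u; last exact: lt_le_trans ts.
by apply: connect_trans st (connect_below_sub _ tu); lra.
Qed.

(** Between adjacent rows of different energies, copying the cheaper onto the dearer would lower the
    energy. *)
Lemma rigid_line_energy s : ~ relaxes s ->
  forall x x', line_energy h (line s x) = line_energy h (line s x').
Proof.
move=> rig; apply: ordS_inv_const => x.
have [lt|gt|//] := ltgtP (line_energy h (line s (ordS x))) (line_energy h (line s x)).
(* Since [copy_line] overwrites the successor of its index, [ord_pred x] makes row [x] the target
   and row [ordS x] the source. *)
- have [||c e] := @copy_line s (ord_pred x) (line s (ordS x));
    rewrite ?ord_predK //; [by right|exact: ltW|].
  rewrite ord_predK in c e.
  by case: rig; exists (set_line s x (line s (ordS x))) => //; lra.
- have [||c e] := @copy_line s x (line s x); [by left|exact: ltW|].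
  by case: rig; exists (set_line s (ordS x) (line s x)) => //; lra.
Qed.

End Copy.

(** * Exchange of rows and columns *)

Section Transpose.
Set Implicit Arguments.
Unset Strict Implicit.
Variables (R : realType) (h : spin -> R).

Definition transpose K L (s : config K L) : config L K := [ffun p => s (p.2, p.1)].

Lemma transposeK K L : cancel (@transpose K L) (@transpose L K).
Proof. by move=> s; apply/ffunP => -[x y]; rewrite !ffunE. Qed.

Lemma energy_transpose K L (s : config K L) : (2 < K)%N -> (2 < L)%N ->
  energy h (transpose s) = energy h s.
Proof.
move=> K_gt2 L_gt2; rewrite !energyE // !card_prod !card_ord [(L * K)%N]mulnC.
congr (_ - _); rewrite /excess.
rewrite (reindex (fun p : site K L => (p.2, p.1))) /=; last first.
  by exists (fun p => (p.2, p.1)) => -[].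
by apply: eq_bigr => -[x y] _; rewrite !ffunE /=; ring.
Qed.

Lemma adjacent_transpose K L (s t : config K L) :
  adjacent s t -> adjacent (transpose s) (transpose t).
Proof.
move/cards1P => [[x y] e]; apply/cards1P; exists (y, x).
apply/setP => -[y' x']; have := congr1 (fun A : {set _} => (x', y') \in A) e.
by rewrite !inE !ffunE /= => ->; rewrite !xpair_eqE andbC.
Qed.

Lemma relaxes_transpose K L (s : config K L) : (2 < K)%N -> (2 < L)%N ->
  relaxes h (transpose s) -> relaxes h s.
Proof.
move=> K_gt2 L_gt2 [t st ts]; exists (transpose t); last first.
  by move: ts; rewrite !energy_transpose.
rewrite energy_transpose // in st; move: (energy h s + 2) st => B /connectP[p pp ->].
rewrite -{1}[s]transposeK.
elim: p (transpose s) pp {ts} => [|v p IH] u /= => [_|/andP[uv pp]]; first exact: connect0.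
apply: connect_trans (IH _ pp); apply: connect1.
move: uv => /andP[uv vB]; rewrite /below /= adjacent_transpose //=.
by rewrite energy_transpose.
Qed.

End Transpose.

(** * Configurations that do not relax are constant *)

Section Rigid.
Set Implicit Arguments.
Unset Strict Implicit.
Variables (R : realType) (h : spin -> R).
Hypothesis nonint : forall a b : int, (a, b) <> (0, 0) ->
  a%:~R * (h s2 - h s1) + b%:~R * (h s3 - h s2) \isn't a Num.int.

Lemma spinP (i : spin) : [\/ i = s1, i = s2 | i = s3].
Proof.
by case: i => -[|[|[|//]]] lti; [constructor 1|constructor 2|constructor 3];
  apply: val_inj.
Qed.

(** Condition (B) makes both integer coefficients of the increments vanish. With spins coded as
    (0,0), (1,0), (1,1), a nonzero difference of two codes determines the ordered pair. *)
Lemma field_diff_inj (a b c d : spin) : h a - h b - (h c - h d) \is a Num.int ->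
  (a = b /\ c = d) \/ (a = c /\ b = d).
Proof.
(* [lv k i] tells whether spin [i] lies above the increment number [k], so [h i] is [h s1] plus the
   increments below it. *)
pose lv k (i : spin) : int := (k < i)%N%:Z.
pose z k := lv k a - lv k b - (lv k c - lv k d).
have hE i : h i = h s1 + (lv 0%N i)%:~R * (h s2 - h s1) + (lv 1%N i)%:~R * (h s3 - h s2).
  by case: (spinP i) => ->; rewrite /lv /=; ring.
have -> : h a - h b - (h c - h d) =
    (z 0%N)%:~R * (h s2 - h s1) + (z 1%N)%:~R * (h s3 - h s2).
  by rewrite (hE a) (hE b) (hE c) (hE d) /z !rmorphB /=; ring.
have [[z0 z1] _|/eqP/nonint/negbTE-> //] := eqVneq (z 0%N, z 1%N) (0, 0).
have lt3 (i : spin) : (i < 3)%N by case: i.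
suff : (a = b :> nat /\ c = d :> nat) \/ (a = c :> nat /\ b = d :> nat).
  by case=> -[/val_inj-> /val_inj->]; [left|right].
have := lt3 a; have := lt3 b; have := lt3 c; have := lt3 d.
by move: z0 z1; rewrite /z /lv; lia.
Qed.

Lemma field_inj : injective h.
Proof.
move=> a b e; have [|[]//|[-> ->]//] := @field_diff_inj a b s1 s1.
by rewrite e !subrr int_num0.
Qed.

(** Disagreements are integers and the fields away from [i] cancel, so modulo the integers only the
    field at [i] remains. *)
Lemma line_energy_update n (r r' : 'I_n -> spin) i :
  (forall j, j != i -> r' j = r j) ->
  line_energy h r' - line_energy h r - (h (r i) - h (r' i)) \is a Num.int.
Proof.
move=> rr'; rewrite /line_energy /local !sumrB.
rewrite [\sum_j h (r' j)](bigD1 i) //= [\sum_j h (r j)](bigD1 i) //=.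
have -> : \sum_(j | j != i) h (r' j) = \sum_(j | j != i) h (r j).
  by apply: eq_bigr => j /rr'->.
set D' := \sum_j dis _ _; set D := \sum_j dis _ _.
rewrite (_ : _ - _ = D' - D); last by ring.
by rewrite rpredB // rpred_sum // => j _; rewrite /dis natr_int.
Qed.

Variables (K L : nat).
Hypotheses (K_gt2 : (2 < K)%N) (L_gt2 : (2 < L)%N).

(** After row [x] is copied onto the next row, the configuration still does not relax. All columns
    have equal energies before and after, so the field change in the overwritten row is, modulo the
    integers, the same in every column. *)
Lemma rigid_lines (s : config K L) : ~ relaxes h s ->
  forall x, line s (ordS x) = line s x.
Proof.
move=> rig x; pose s' := set_line s (ordS x) (line s x).
have lineE := rigid_line_energy K_gt2 L_gt2 rig.
have rig' : ~ relaxes h s'.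
  move=> rel'; apply: rig; have [||c e] := @copy_line _ _ _ h K_gt2 L_gt2 s x (line s x).
  - by left.
  - by rewrite (lineE x (ordS x)).
  - by apply: relaxes_trans c _ rel'; move: e; rewrite (lineE x (ordS x)); lra.
have colE y y' : line_energy h (line (transpose s) y) = line_energy h (line (transpose s) y').
  by apply: rigid_line_energy => // /(relaxes_transpose K_gt2 L_gt2).
have colE' y y' : line_energy h (line (transpose s') y) = line_energy h (line (transpose s') y').
  by apply: rigid_line_energy => // /(relaxes_transpose K_gt2 L_gt2).
have upd y : line_energy h (line (transpose s') y) - line_energy h (line (transpose s) y)
    - (h (line s (ordS x) y) - h (line s x y)) \is a Num.int.
  have -> : line s (ordS x) y = line (transpose s) y (ordS x) by rewrite /line ffunE.
  have -> : line s x y = line (transpose s') y (ordS x) by rewrite /line !ffunE /= eqxx.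
  by apply: line_energy_update => j jx; rewrite /line !ffunE /= (negbTE jx).
have diff y y' : (line s (ordS x) y = line s x y /\ line s (ordS x) y' = line s x y') \/
    (line s (ordS x) y = line s (ordS x) y' /\ line s x y = line s x y').
  apply: field_diff_inj; rewrite (_ : h _ - _ - _ =
      (line_energy h (line (transpose s') y') - line_energy h (line (transpose s) y')
        - (h (line s (ordS x) y') - h (line s x y'))) -
      (line_energy h (line (transpose s') y) - line_energy h (line (transpose s) y)
        - (h (line s (ordS x) y) - h (line s x y)))); first exact: rpredB.
  rewrite (colE y y') (colE' y y'); ring.
apply: contrapT => /eqP ne.
have [y ny] : exists y, line s (ordS x) y != line s x y.
  apply/existsP; apply: contraNT ne => /existsPn e; apply/eqP/funext => y.
  by apply/eqP; rewrite -[_ == _]negbK.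
(* In column [y] the two rows differ, which leaves only the second alternative of [diff]: both rows
   are constant. Their equal energies then give equal fields, hence equal spins. *)
have cst x' : (forall y', line s x' y' = line s x' y) ->
    line_energy h (line s x') = L%:R * - h (line s x' y).
  move=> e; rewrite /line_energy /local (eq_bigr (fun=> - h (line s x' y))).
    by rewrite sumr_const card_ord mulr_natl.
  by move=> y' _; rewrite !e disxx sub0r.
have := lineE x (ordS x); rewrite !cst => [|y'|y'].
- have L_neq0 : L%:R != 0 :> R by rewrite pnatr_eq0; lia.
  by move/(mulfI L_neq0)/oppr_inj/field_inj => e; rewrite e eqxx in ny.
- by case: (diff y y') => -[e _]; [rewrite e eqxx in ny | rewrite e].
- by case: (diff y y') => -[e e']; [rewrite e eqxx in ny | rewrite e'].
Qed.

End Rigid.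

Lemma rigid_const {R : realType} {K L : nat} {h : spin -> R} {s : config K L} :
  (forall a b : int, (a, b) <> (0, 0) ->
     a%:~R * (h s2 - h s1) + b%:~R * (h s3 - h s2) \isn't a Num.int) ->
  (2 < K)%N -> (2 < L)%N -> ~ relaxes h s -> exists i, s = const_config K L i.
Proof.
move=> nonint K_gt2 L_gt2 rig.
have rigT : ~ relaxes h (transpose s) by move=> /(relaxes_transpose K_gt2 L_gt2).
have row := rigid_lines nonint K_gt2 L_gt2 rig.
have col := rigid_lines nonint L_gt2 K_gt2 rigT.
have x0 : 'I_K by apply: (@Ordinal _ 0); lia.
have y0 : 'I_L by apply: (@Ordinal _ 0); lia.
exists (s (x0, y0)); apply/ffunP => -[x y]; rewrite ffunE.
have -> : s (x, y) = s (x0, y).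
  by have /(congr1 (fun r => r y)) := ordS_inv_const row x x0.
have /(congr1 (fun r => r x0)) := ordS_inv_const col y y0.
by rewrite /line !ffunE.
Qed.

(** * Stability levels and paths *)

Section Stability.
Set Implicit Arguments.
Unset Strict Implicit.
Variables (R : realType) (K L : nat) (h : spin -> R).
Implicit Types (s t : config K L).

Lemma path_heightP s p B :
  reflect (energy h s <= B /\ {in p, forall u, energy h u <= B}) (path_height h s p <= B).
Proof.
rewrite /path_height; elim: p => [|v p IH].
  by rewrite big_nil; apply: (iffP idP) => [|[]//]; split.
rewrite big_cons ge_max; apply: (iffP andP) => [[vB /IH[sB pB]]|[sB pB]].
  by split=> // u; rewrite inE => /predU1P[->|/pB].
split; first by apply: pB; rewrite mem_head.
by apply/IH; split=> // u up; apply: pB; rewrite inE up orbT.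
Qed.

Lemma stability_level_le s t p B : is_path s t p -> energy h t < energy h s ->
  path_height h s p <= B -> (stability_level h s <= (B - energy h s)%:E)%E.
Proof.
move=> st ts pB; rewrite /stability_level; case: eqP => [A0|_].
  by have := finset.in_set0 t; rewrite -A0 inE ts.
rewrite EFinB leeB // /comm_height_set.
apply: (@bigmin_inf _ _ _ _ t); first by rewrite inE.
by apply: (@le_trans _ _ (path_height h s p)%:E); rewrite ?lee_fin //;
  apply: ereal_inf_lbound; exists p.
Qed.

Lemma path_height_lt s p B : energy h s < B ->
  {in p, forall u, energy h u < B} -> path_height h s p < B.
Proof.
rewrite /path_height => sB; elim: p => [|v p IH] pB; first by rewrite big_nil.
rewrite big_cons gt_max pB ?mem_head //=.
by apply: IH => u up; apply: pB; rewrite inE up orbT.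
Qed.

(** A finite level is realized by some path to a lower energy; [stability_level_le] supplies the
    comparison with other paths. *)
Variant stability_level_spec s : \bar R -> Prop :=
| StableInfinite : stability_level_spec s +oo%E
| StableFinite t p of is_path s t p & energy h t < energy h s :
    stability_level_spec s (path_height h s p - energy h s)%:E.

Lemma stability_levelP s : stability_level_spec s (stability_level h s).
Proof.
rewrite /stability_level; case: eqP => [_|/eqP/finset.set0Pn[t0 ts0]].
  by constructor.
rewrite /barrier /comm_height_set.
have le_oo t : t \in lower_energy h s -> (comm_height h s t <= +oo)%E.
  by move=> _; apply: leey.
have [t ts ->] := @eq_bigmin _ _ _ _ t0 (fun t => t \in lower_energy h s) _ ts0 le_oo.
have [p st ->] := comm_height_attained h s t.
by rewrite -EFinB; apply: StableFinite st _; rewrite inE in ts.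
Qed.

Lemma connect_path_height B s t : energy h s <= B -> connect (below h B) s t ->
  exists2 p, is_path s t p & path_height h s p <= B.
Proof.
move=> sB /connectP[p pp ->]; exists p.
  by split=> //; apply: sub_path pp => u v /andP[].
apply/path_heightP; split=> // u; elim: p s pp {sB} => // v p IH s /=.
move=> /andP[/andP[_ vB] pp]; rewrite inE => /predU1P[->//|]; exact: IH pp.
Qed.

(** Two vertical disagreements and one horizontal one at the flipped site already cost 3, and the
    field gives back less than 1. *)
Lemma energy_leave_const i s : (2 < K)%N -> (2 < L)%N ->
  (forall j k, h j - h k < 1) -> adjacent (const_config K L i) s ->
  energy h (const_config K L i) + 2 < energy h s.
Proof.
move=> K_gt2 L_gt2 h_lt1 /cards1P[[x y] e]; set c := const_config K L i in e *.
have diffE p : (i != s p) = (p == (x, y)).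
  by have := congr1 (fun A : {set _} => p \in A) e; rewrite !inE ffunE.
pose r y' : spin := if y' == y then s (x, y) else i.
(* Viewing the flip as the replacement of a whole row makes [energy_set_line] applicable. *)
have sE : s = set_line c (ordS (ord_pred x)) r.
  apply/ffunP => -[x' y']; rewrite !ffunE ord_predK /=.
  have := diffE (x', y'); rewrite xpair_eqE /r.
  case: (eqVneq x' x) => [->|_] /=; last by move/negbFE/eqP.
  by case: (eqVneq y' y) => [->//|_] /negbFE/eqP.
have iy : i != s (x, y) by rewrite diffE.
have lineE x' : line c x' = fun=> i by apply/funext => y'; rewrite /line ffunE.
have one (F : 'I_L -> R) : (forall y', 0 <= F y') -> F y = 1 -> 1 <= \sum_y' F y'.
  by move=> F0 Fy; rewrite (bigD1 y) //= Fy lerDl sumr_ge0.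
have := energy_set_line h K_gt2 L_gt2 c (ord_pred x) r.
rewrite -sE !lineE /=.
have -> : @gap R L (fun=> i) (fun=> i) = 0 by rewrite /gap big1 // => *; rewrite disxx.
have g1 : 1 <= gap R (fun=> i) r.
  by apply: one => [*|]; rewrite ?dis_ge0 // /dis /r eqxx iy.
have g2 : 1 <= gap R r (fun=> i).
  by apply: one => [*|]; rewrite ?dis_ge0 // /dis /r eqxx eq_sym iy.
have d1 : 1 <= \sum_y' dis (r y') (r (ordS y')) :> R.
  apply: one => [*|]; first exact: dis_ge0.
  by rewrite /dis /r eqxx (negbTE (ordS_neq _ _)) 1?eq_sym ?iy //; lia.
have -> : @line_energy R h L (fun=> i) = - \sum_(y' < L) h i.
  by rewrite -sumrN; apply: eq_bigr => y' _; rewrite /local disxx sub0r.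
have -> : line_energy h r = \sum_y' dis (r y') (r (ordS y')) - \sum_y' h (r y').
  by rewrite -sumrB.
have -> : \sum_y' h (r y') = h (s (x, y)) - h i + \sum_(y' < L) h i.
  rewrite (bigD1 y) //= [in RHS](bigD1 y) //= /r eqxx addrA subrK; congr (_ + _).
  by apply: eq_bigr => y' /negbTE->.
have := h_lt1 (s (x, y)) i; lra.
Qed.

Lemma leave_const_height i t p : (2 < K)%N -> (2 < L)%N ->
  (forall j k, h j - h k < 1) -> is_path (const_config K L i) t p ->
  energy h t < energy h (const_config K L i) ->
  energy h (const_config K L i) + 2 < path_height h (const_config K L i) p.
Proof.
move=> K_gt2 L_gt2 h_lt1; case: p => [|u p] [/= pp <-]; first by rewrite ltxx.
case/andP: pp => cu _ _; apply: lt_le_trans (energy_leave_const K_gt2 L_gt2 h_lt1 cu) _.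
have /path_heightP[_] := lexx (path_height h (const_config K L i) (u :: p)).
by apply; rewrite mem_head.
Qed.

(** * Comparison of the constants 1 and 2 *)

Definition demote s : config K L := [ffun x => if s x == s3 then s3 else s1].

(** Demotion may identify two adjacent configurations, hence connectivity in place of adjacency. *)
Lemma adjacent_demote B s t : adjacent s t -> energy h (demote t) <= B ->
  connect (below h B) (demote s) (demote t).
Proof.
move=> /cards1P[x e] tB; apply: connect_below1 => // p q.
have diff z : demote s z != demote t z -> z = x.
  move=> ne; apply/set1P; rewrite -e inE; apply: contraNneq ne.
  by rewrite !ffunE => ->.
by move=> /diff-> /diff->.
Qed.

Lemma demote_const2 : demote (const_config K L s2) = const_config K L s1.
Proof. by apply/ffunP => x; rewrite !ffunE. Qed.

Lemma excess_const i : excess h (const_config K L i) = \sum_(x : site K L) - h i.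
Proof. by apply: eq_bigr => x _; rewrite !ffunE !disxx add0r sub0r. Qed.

(** Demotion creates no disagreement. Relative to the constants, the field term gains [h s2 - h s1]
    at each site of spin 1 or 3 and nothing at spin 2, so one site of spin other than 2 gives
    strictness. *)
Lemma energy_demote s : (2 < K)%N -> (2 < L)%N -> h s1 < h s2 -> h s2 < h s3 ->
  s != const_config K L s2 ->
  energy h (demote s) - energy h (const_config K L s1)
    < energy h s - energy h (const_config K L s2).
Proof.
move=> K_gt2 L_gt2 h12 h23 ne.
have [x sx] : exists x, s x != s2.
  apply/existsP; apply: contraNT ne => /existsPn e; apply/eqP/ffunP => x.
  by rewrite ffunE; apply/eqP; rewrite -[_ == _]negbK.
rewrite !energyE // !excess_const /excess -subr_gt0.
set N := _%:R; rewrite (_ : _ - _ = \sum_y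
  (dis (s y) (s (step true y)) - dis (demote s y) (demote s (step true y))
   + (dis (s y) (s (step false y)) - dis (demote s y) (demote s (step false y)))
   + (h (demote s y) - h s1 - (h (s y) - h s2)))); last first.
  rewrite !big_split /= !sumrN !sumrB; ring.
have dis_demote y z : 0 <= dis (s y) (s z) - dis (demote s y) (demote s z) :> R.
  rewrite subr_ge0 /dis !ffunE ler_nat.
  by have [->|_] := eqVneq (s y) (s z); rewrite ?eqxx ?leq_b1.
have h_demote y : 0 <= h (demote s y) - h s1 - (h (s y) - h s2).
  by rewrite ffunE; case: (spinP (s y)) => -> /=; lra.
rewrite (bigD1 x) //=; apply: ltr_wpDr.
  by apply: sumr_ge0 => y _; rewrite addr_ge0 ?h_demote // addr_ge0 ?dis_demote.
apply: ltr_wpDl; first by rewrite addr_ge0 ?dis_demote.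
by move: sx; rewrite ffunE; case: (spinP (s x)) => -> //= _; lra.
Qed.

Lemma stability_const1_lt_const2 : (2 < K)%N -> (2 < L)%N ->
  (forall j k, h j - h k < 1) -> h s1 < h s2 -> h s2 < h s3 ->
  (stability_level h (const_config K L s1) <
    stability_level h (const_config K L s2))%E.
Proof.
move=> K_gt2 L_gt2 h_lt1 h12 h23.
set c1 := const_config K L s1; set c2 := const_config K L s2.
suff bound t p : is_path c2 t p -> energy h t < energy h c2 ->
    (stability_level h c1 < (path_height h c2 p - energy h c2)%:E)%E.
  have [p0 c2p0] := path_exists c2 (const_config K L s3).
  case: (stability_levelP c2) => [|t p]; last exact: bound.
  (* In the infinite case, a path to the constant 3, whose energy is lower, still shows that the
     level of [c1] is finite. *)
  apply: lt_trans (ltry _); apply: bound c2p0 _.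
  rewrite !energyE // !excess_const ltrD2r !sumr_const ltr_pMn2r ?ltrN2 //.
  by rewrite card_prod !card_ord muln_gt0; lia.
move=> c2t tc2; have tall := leave_const_height K_gt2 L_gt2 h_lt1 c2t tc2.
pose B := path_height h c1 (map demote p).
have BE u : energy h u <= path_height h c2 p ->
    energy h (demote u) < path_height h c2 p - energy h c2 + energy h c1.
  (* At [c2] demotion gains nothing; strictness comes from [tall], as the path rises by more than 2
     above [c2]. *)
  have [->|ne] := eqVneq u c2; first by rewrite demote_const2 -/c1; lra.
  by have := energy_demote K_gt2 L_gt2 h12 h23 ne; rewrite -/c1 -/c2; lra.
have /path_heightP[c2h ph] := lexx (path_height h c2 p).
have B_lt : B < path_height h c2 p - energy h c2 + energy h c1.
  apply: path_height_lt => [|_ /mapP[u up ->]]; last exact: BE (ph u up).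
  by have := BE c2 c2h; rewrite demote_const2.
have /path_heightP[c1B pB] := lexx B.
have c1t : connect (below h B) c1 (demote t).
  clearbody B; case: c2t => pp <-; rewrite /c1 -demote_const2 -/c2.
  elim: p (c2) pp pB {BE c2h ph B_lt tall} => [|v p IH] u /=; first by rewrite connect0.
  move=> /andP[uv pp] pB; apply: (@connect_trans _ _ (demote v)).
    by apply: adjacent_demote uv _; apply: pB; rewrite mem_head.
  by apply: IH pp _ => w wp; apply: pB; rewrite inE wp orbT.
have [q c1q qB] := connect_path_height c1B c1t.
have tc1 : energy h (demote t) < energy h c1.
  have [tE|ne] := eqVneq t c2; first by rewrite tE ltxx in tc2.
  by have := energy_demote K_gt2 L_gt2 h12 h23 ne; rewrite -/c1 -/c2; lra.
apply: le_lt_trans (stability_level_le c1q tc1 qB) _.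
by rewrite lte_fin; lra.
Qed.

End Stability.

Theorem theorem2p3 (R : realType) (K L : nat) (h : spin -> R)
  (K_gt0 : (0 < K)%N) (L_gt0 : (0 < L)%N)
  (h1_gt0 : 0 < h s1) (h12 : h s1 < h s2) (h23 : h s2 < h s3) (h3_lt1 : h s3 < 1)
  (K_gt_32 : 3%:R / (h s3 - h s2) < K%:R) (K_gt_21 : 3%:R / (h s2 - h s1) < K%:R)
  (L_gt_32 : 3%:R / (h s3 - h s2) < L%:R) (L_gt_21 : 3%:R / (h s2 - h s1) < L%:R)
  (nonint : forall a b : int, (a, b) <> (0, 0) ->
     a%:~R * (h s2 - h s1) + b%:~R * (h s3 - h s2) \isn't a Num.int)
  (sigma : config K L)
  (sigma_ne1 : sigma <> const_config K L s1) (sigma_ne2 : sigma <> const_config K L s2)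
  (sigma_ne3 : sigma <> const_config K L s3) :
  (stability_level h sigma < stability_level h (const_config K L s1))%E /\
  (stability_level h (const_config K L s1) <
     stability_level h (const_config K L s2))%E.
Proof.
(* The field difference lies strictly between 0 and 1, so the quotient exceeds 2. *)
have gt2 n : 3%:R / (h s3 - h s2) < n%:R -> (2 < n)%N.
  move=> n_gt; rewrite -(ltr_nat R); apply: lt_trans n_gt.
  by rewrite ltr_pdivlMr; lra.
have K_gt2 := gt2 K K_gt_32; have L_gt2 := gt2 L L_gt_32.
have h_lt1 j k : h j - h k < 1.
  by case: (spinP j) => ->; case: (spinP k) => ->; lra.
split; last exact: stability_const1_lt_const2.
have [t st ts] : relaxes h sigma.
  apply: contrapT => /(rigid_const nonint K_gt2 L_gt2)[i sE].
  by case: (spinP i) => iE; rewrite iE in sE.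
have sB : energy h sigma <= energy h sigma + 2 by lra.
have [p pst pB] := connect_path_height sB st.
apply: le_lt_trans (stability_level_le pst ts pB) _.
case: (stability_levelP h (const_config K L s1)) => [|u q c1q uc1]; first exact: ltry.
have := leave_const_height K_gt2 L_gt2 h_lt1 c1q uc1.
by rewrite lte_fin; lra.
Qed.
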